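(* Let $p$ be a prime. For any $p$-adic Möbius map $g\in\mathrm{PSL}(2,\mathbb{C}_p)$, $$2^{-1}\varepsilon_1(g)\le M(g)\le\varepsilon_1(g),$$ where $\varepsilon_1(g)=\max\{\rho_v(g(0),0),\rho_v(g(1),1),\rho_v(g(\infty),\infty)\}$.
   Context: $\mathbb{C}_p$ is the completion of the algebraic closure of $\mathbb{Q}_p$, with $|p|=p^{-1}$. A $p$-adic Möbius map is an element of $\mathrm{PSL}(2,\mathbb{C}_p)=\mathrm{SL}(2,\mathbb{C}_p)/\{\pm I\}$, acting on $\mathbb{P}^1(\mathbb{C}_p)=\mathbb{C}_p\cup\{\infty\}$ by $z\mapsto\frac{az+b}{cz+d}$, $ad-bc=1$. Chordal metric: $\rho_v(z,w)=\frac{|z-w|}{\max\{1,|z|\}\max\{1,|w|\}}$ for $z,w\in\mathbb{C}_p$, $\rho_v(\infty,w)=\rho_v(w,\infty)=\frac1{\max\{1,|w|\}}$ for $w\in\mathbb{C}_p$, $\rho_v(\infty,\infty)=0$. Matrix norm: $\|(a_{ij})\|=\max_{i,j}|a_{ij}|$; $\|g\|$ is the norm of either lift of $g$ to $\mathrm{SL}(2,\mathbb{C}_p)$. Define $M(g)=\|g-g^{-1}\|/\|g\|$, where $g-g^{-1}$ is the difference of a lift of $g$ and the inverse matrix of that same lift; i.e. for $g(z)=\frac{az+b}{cz+d}$ with $ad-bc=1$, $M(g)=\frac{\max\{|a-d|,|2b|,|2c|\}}{\max\{|a|,|b|,|c|,|d|\}}$. *)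

(* Defs.v *)
From HB Require Import structures.
From mathcomp Require Import all_boot all_order all_algebra.
From mathcomp Require Import reals.

Set Implicit Arguments.
Unset Strict Implicit.
Unset Printing Implicit Defensive.

Import Order.TTheory GRing.Theory Num.Theory.
Local Open Scope ring_scope.
Local Open Scope quotient_scope.

Record nonarch_absval (R : realType) (K : fieldType) (v : K -> R) : Prop := {
  absval_ge0 : forall x, 0 <= v x;
  absval_eq0 : forall x, v x = 0 <-> x = 0;
  absvalM : forall x y, v (x * y) = v x * v y;
  absvalD : forall x y, v (x + y) <= Num.max (v x) (v y)
}.

Definition absval_cauchy (R : realType) (K : fieldType) (v : K -> R)
    (u : nat -> K) : Prop :=
  forall e : R, 0 < e ->
    exists N : nat, forall m n, (N <= m)%N -> (N <= n)%N -> v (u m - u n) < e.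

Definition absval_cvg (R : realType) (K : fieldType) (v : K -> R)
    (u : nat -> K) (l : K) : Prop :=
  forall e : R, 0 < e ->
    exists N : nat, forall n, (N <= n)%N -> v (u n - l) < e.

Record is_completion (R : realType) (K L : fieldType) (v : K -> R) (w : L -> R)
    (f : {rmorphism K -> L}) : Prop := {
  completion_absval : nonarch_absval w;
  completion_isometry : forall x, w (f x) = v x;
  completion_dense : forall (y : L) (e : R), 0 < e -> exists x, w (y - f x) < e;
  completion_complete : forall u, absval_cauchy w u -> exists l, absval_cvg w u l
}.

(* The p-adic absolute value on the rationals, with |p| = p^-1. *)
Definition padic_absval (R : realType) (p : nat) (x : rat) : R :=
  if x == 0 then 0
  else p%:R ^+ logn p `|denq x|%N / p%:R ^+ logn p `|numq x|%N.

(* (Cp, v) is a completion of an algebraic closure Qpbar of the completion Qp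
   of the rationals; Qpbar carries an absolute value extending that of Qp.
   This determines (Cp, v) up to isometric isomorphism. *)
Definition is_Cp (R : realType) (p : nat) (Cp : fieldType) (v : Cp -> R) : Prop :=
  exists (Qp : fieldType) (vQp : Qp -> R) (i : {rmorphism rat -> Qp})
         (Qpbar : closedFieldType) (vQpbar : Qpbar -> R)
         (j : {rmorphism Qp -> Qpbar}) (k : {rmorphism Qpbar -> Cp}),
    [/\ is_completion (padic_absval R p) vQp i,
        forall x : Qpbar, algebraicOver j x,
        nonarch_absval vQpbar,
        forall x : Qp, vQpbar (j x) = vQp x
      & is_completion vQpbar v k].

Definition SL2 (K : fieldType) := {A : 'M[K]_2 | \det A == 1}.

Definition eq_upto_sign (K : fieldType) (A B : SL2 K) : bool :=
  (val A == val B) || (val A == - val B).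

Lemma eq_upto_sign_equiv (K : fieldType) :
  equiv_class_of (@eq_upto_sign K).
Proof.
split=> [A | A B | B A C].
- by rewrite /eq_upto_sign eqxx.
- by rewrite /eq_upto_sign [val A == val B]eq_sym -eqr_oppLR [- val A == _]eq_sym.
- rewrite /eq_upto_sign => /orP[]/eqP-> /orP[]/eqP->;
    by rewrite ?opprK eqxx ?orbT.
Qed.

Canonical eq_upto_sign_equivrel (K : fieldType) :=
  EquivRelPack (@eq_upto_sign_equiv K).

Definition PSL2 (K : fieldType) := {eq_quot (@eq_upto_sign_equivrel K)}.

(* repr picks one of the two lifts; mobius_pi, mobius_norm_pi and mobius_M_pi
   below show that the choice is immaterial. *)
Definition lift_mx (K : fieldType) (g : PSL2 K) : 'M[K]_2 := val (repr g).

Lemma lift_mx_pi (K : fieldType) (A : SL2 K) :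
  lift_mx (\pi_(PSL2 K) A) = val A \/ lift_mx (\pi_(PSL2 K) A) = - val A.
Proof.
have /eqP := @reprK _ (PSL2 K) (\pi A).
rewrite eqmodE /= /eq_upto_sign -/(lift_mx _) => /orP[]/eqP->; by [left|right].
Qed.

(* The projective line over K; None is the point at infinity. *)
Definition P1 (K : fieldType) := option K.

Definition mx_act (K : fieldType) (A : 'M[K]_2) (z : P1 K) : P1 K :=
  let a := A 0 0 in let b := A 0 1 in let c := A 1 0 in let d := A 1 1 in
  match z with
  | Some x => if c * x + d == 0 then None else Some ((a * x + b) / (c * x + d))
  | None => if c == 0 then None else Some (a / c)
  end.

Definition mx_norm (R : realType) (K : fieldType) (v : K -> R)
    (A : 'M[K]_2) : R :=
  \big[Num.max/0]_(i < 2) \big[Num.max/0]_(j < 2) v (A i j).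

Definition mobius (K : fieldType) (g : PSL2 K) : P1 K -> P1 K :=
  mx_act (lift_mx g).

Definition mobius_norm (R : realType) (K : fieldType) (v : K -> R)
    (g : PSL2 K) : R :=
  mx_norm v (lift_mx g).

Definition mobius_M (R : realType) (K : fieldType) (v : K -> R)
    (g : PSL2 K) : R :=
  mx_norm v (lift_mx g - invmx (lift_mx g)) / mobius_norm v g.

Definition chordal (R : realType) (K : fieldType) (v : K -> R)
    (z w : P1 K) : R :=
  match z, w with
  | Some x, Some y => v (x - y) / (Num.max 1 (v x) * Num.max 1 (v y))
  | None, Some y => 1 / Num.max 1 (v y)
  | Some x, None => 1 / Num.max 1 (v x)
  | None, None => 0
  end.

Definition epsilon1 (R : realType) (K : fieldType) (v : K -> R)
    (g : PSL2 K) : R :=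
  Num.max (chordal v (mobius g (Some 0)) (Some 0))
    (Num.max (chordal v (mobius g (Some 1)) (Some 1))
             (chordal v (mobius g None) None)).

Lemma mx_actN (K : fieldType) (A : 'M[K]_2) z : mx_act (- A) z = mx_act A z.
Proof.
have divNN (x y : K) : - x / - y = x / y by rewrite invrN mulrNN.
have linN (x y z0 : K) : - x * z0 - y = - (x * z0 + y) by rewrite mulNr opprD.
by case: z => [x|] /=; rewrite !mxE ?linN oppr_eq0 divNN.
Qed.

Lemma absvalN (R : realType) (K : fieldType) (v : K -> R) (x : K) :
  nonarch_absval v -> v (- x) = v x.
Proof.
move=> hv; have v1 : v 1 = 1.
  have /eqP v1_neq0 : v 1 <> 0 by move/(absval_eq0 hv)/eqP; rewrite oner_eq0.
  by apply: (mulfI v1_neq0); rewrite -(absvalM hv) !mulr1.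
have vN1 : v (-1) = 1.
  apply/eqP; rewrite -(@eqrXn2 _ 2) ?(absval_ge0 hv) //.
  by rewrite expr2 -(absvalM hv) mulrNN mulr1 v1 expr1n.
by rewrite -mulN1r (absvalM hv) vN1 mul1r.
Qed.

Lemma mx_normN (R : realType) (K : fieldType) (v : K -> R) (A : 'M[K]_2) :
  nonarch_absval v -> mx_norm v (- A) = mx_norm v A.
Proof.
move=> hv; apply: eq_bigr => i _; apply: eq_bigr => j _.
by rewrite mxE absvalN.
Qed.

Lemma mobius_pi (K : fieldType) (A : SL2 K) z :
  mobius (\pi_(PSL2 K) A) z = mx_act (val A) z.
Proof.
by rewrite /mobius; case: (lift_mx_pi A) => ->; rewrite ?mx_actN.
Qed.

Lemma mobius_norm_pi (R : realType) (K : fieldType) (v : K -> R) (A : SL2 K) :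
  nonarch_absval v -> mobius_norm v (\pi_(PSL2 K) A) = mx_norm v (val A).
Proof.
by move=> hv; rewrite /mobius_norm; case: (lift_mx_pi A) => ->;
  rewrite ?mx_normN.
Qed.

Lemma mobius_M_pi (R : realType) (K : fieldType) (v : K -> R) (A : SL2 K) :
  nonarch_absval v ->
  mobius_M v (\pi_(PSL2 K) A)
    = mx_norm v (val A - invmx (val A)) / mx_norm v (val A).
Proof.
move=> hv; rewrite /mobius_M mobius_norm_pi //.
case: (lift_mx_pi A) => -> //; congr (_ / _).
by rewrite -[invmx (- _)]/((- val A)^-1) invrN -opprD mx_normN.
Qed.

(* Main.v *)
Require Import Defs.
From HB Require Import structures.
From mathcomp Require Import all_boot all_order all_algebra.
From mathcomp Require Import reals ring.

(** Write [N] for the norm of a lift [A = (a b; c d)], so that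
    [M(g) = D / N] with [D = max (|a - d|, |2 b|, |2 c|)].  In homogeneous
    coordinates the chordal distance of [x : y] and [z : w] is
    [|x w - z y| / (max (|x|, |y|) max (|z|, |w|))] ([chordal_proj_pt]), so the
    three terms of [epsilon1] are
    [|b| / max (|b|, |d|)], [|(a + b) - (c + d)| / max (|a + b|, |c + d|)] and
    [|c| / max (|a|, |c|)].

    Their denominators are at most [N], so [|b|], [|c|] and, as
    [a - d = ((a + b) - (c + d)) - b + c], also [|a - d|] are at most
    [N * epsilon1]; hence [M <= epsilon1].

    Over any nonarchimedean valued field the other inequality holds in the form
    [|2| epsilon1 <= M].  If [|2| N <= D] this is clear, because chordal
    distances are at most 1.  If [D < |2| N], then [b], [c] and [a - d] all have
    absolute value below [N], so the norm is attained at both [a] and [d]; the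
    three denominators are then equal to [N], while [|2|] times any of the
    numerators is at most [D].  Finally [|2| >= 1/2] in C_p, whatever [p] is. *)

Set Implicit Arguments.
Unset Strict Implicit.
Unset Printing Implicit Defensive.

Import Order.TTheory GRing.Theory Num.Theory.
Local Open Scope ring_scope.

(** * Nonarchimedean absolute values and the chordal metric *)

Lemma lift_ord0_0 : lift ord0 (ord0 : 'I_1) = 1 :> 'I_2.
Proof. exact/val_inj. Qed.

Section NonarchimedeanAbsval.
Variables (R : realType) (K : fieldType) (v : K -> R).
Hypothesis hv : nonarch_absval v.

Let v_ge0 x : 0 <= v x. Proof. exact: absval_ge0 hv x. Qed.

Lemma absval0 : v 0 = 0. Proof. exact/(absval_eq0 hv). Qed.

Lemma absval_eq0E x : (v x == 0) = (x == 0).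
Proof. by apply/eqP/eqP => /(absval_eq0 hv). Qed.

Lemma absval1 : v 1 = 1.
Proof.
have v1_neq0 : v 1 != 0 by rewrite absval_eq0E oner_eq0.
by apply: (mulfI v1_neq0); rewrite -(absvalM hv) !mulr1.
Qed.

Lemma absvalB x y : v (x - y) <= Num.max (v x) (v y).
Proof. by rewrite -(absvalN y hv); exact: absvalD hv x (- y). Qed.

Lemma absvalBC x y : v (x - y) = v (y - x).
Proof. by rewrite -(absvalN _ hv) opprB. Qed.

Lemma absval_nat_le1 n : v n%:R <= 1.
Proof.
elim: n => [|n IHn]; first by rewrite absval0.
by rewrite -natr1 (le_trans (absvalD hv _ _)) // ge_max IHn absval1 lexx.
Qed.

Lemma absval_div x y : y != 0 -> v (x / y) = v x / v y.
Proof.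
move=> y0; have vy0 : v y != 0 by rewrite absval_eq0E.
by apply: (mulIf vy0); rewrite -(absvalM hv) !divfK.
Qed.

(** Half of the fact that ultrametric triangles are isosceles. *)
Lemma absval_le_of_near t x y : v (x - y) < t -> t <= v x -> t <= v y.
Proof.
move=> xy_lt /le_trans tx; have := absvalD hv (x - y) y.
by rewrite subrK => /tx; rewrite le_max leNgt xy_lt.
Qed.

Lemma mx_normE (A : 'M[K]_2) : mx_norm v A =
  Num.max (Num.max (v (A 0 0)) (v (A 0 1))) (Num.max (v (A 1 0)) (v (A 1 1))).
Proof.
rewrite /mx_norm !big_ord_recl !big_ord0 /= lift_ord0_0.
by rewrite !(max_l (v_ge0 _)) [Num.max (Num.max _ _) 0]max_l // le_max !v_ge0.
Qed.

Lemma absval_entry_le_norm (A : 'M[K]_2) :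
  [/\ v (A 0 0) <= mx_norm v A, v (A 0 1) <= mx_norm v A,
      v (A 1 0) <= mx_norm v A & v (A 1 1) <= mx_norm v A].
Proof. by rewrite mx_normE; split; rewrite !le_max lexx ?orbT. Qed.

(** The point of the projective line with homogeneous coordinates [[x : y]];
    [mx_act] is linear in these coordinates. *)
Definition proj_pt (x y : K) : P1 K := if y == 0 then None else Some (x / y).

Lemma max_absval_gt0 x y : (x != 0) || (y != 0) -> 0 < Num.max (v x) (v y).
Proof. by rewrite lt_max !lt_def !absval_eq0E !v_ge0 !andbT. Qed.

Lemma max1_absval_div x y : y != 0 ->
  Num.max 1 (v (x / y)) = Num.max (v x) (v y) / v y.
Proof.
move=> y0; have vy0 : 0 < v y by rewrite lt_def absval_eq0E y0 v_ge0.
rewrite absval_div // [RHS]mulrC maxr_pMr ?invr_ge0 ?v_ge0 //.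
by rewrite mulVf ?gt_eqF // maxC [_ * v x]mulrC.
Qed.

(** The absolute value of the determinant of the two coordinate vectors over
    the product of their norms: this form treats infinity like any other point,
    so the poles of a Mobius map need no separate case. *)
Lemma chordal_proj_pt x y z w : (x != 0) || (y != 0) -> (z != 0) || (w != 0) ->
  chordal v (proj_pt x y) (proj_pt z w) =
    v (x * w - z * y) / (Num.max (v x) (v y) * Num.max (v z) (v w)).
Proof.
move=> xy zw; have [mx mz] := (max_absval_gt0 xy, max_absval_gt0 zw).
rewrite /proj_pt; have [y0|y0] := eqVneq y 0; have [w0|w0] := eqVneq w 0 => /=.
- by rewrite y0 w0 !mulr0 subr0 absval0 mul0r.
- move: xy mx; rewrite y0 eqxx orbF absval0 mulr0 subr0 => x0.
  rewrite (max_l (v_ge0 x)) (absvalM hv x w) max1_absval_div // => vx0.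
  by rewrite div1r invf_div -mulf_div divff ?gt_eqF ?mul1r.
- move: zw mz; rewrite w0 eqxx orbF absval0 mulr0 sub0r (absvalN _ hv) => z0.
  rewrite (max_l (v_ge0 z)) (absvalM hv z y) max1_absval_div // => vz0.
  by rewrite div1r invf_div [_ * v z in RHS]mulrC -mulf_div divff ?gt_eqF ?mul1r.
- rewrite !max1_absval_div // mulf_div.
  have -> : x / y - z / w = (x * w - z * y) / (y * w).
    by rewrite -mulNr addf_div // mulNr.
  rewrite absval_div ?mulf_neq0 // (absvalM hv y) invf_div.
  by rewrite mulrA divfK // mulf_neq0 // absval_eq0E.
Qed.

End NonarchimedeanAbsval.

(** * Two-by-two matrices of determinant 1 *)

Lemma det_mx22 (K : comNzRingType) (A : 'M[K]_2) :
  \det A = A 0 0 * A 1 1 - A 0 1 * A 1 0.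
Proof.
rewrite (expand_det_row _ ord0) big_ord_recl big_ord1 /cofactor !det_mx11 !mxE.
rewrite lift_ord0_0; have -> : lift 1 0 = 0 :> 'I_2 by exact/val_inj.
by rewrite /= !expr0 mul1r expr1 mulN1r mulrN.
Qed.

(** Cayley-Hamilton in size 2, where it reads [A + A^-1 = \tr A]; it makes
    [A - A^-1] equal to [2 A - \tr A], whose entries are those in [M(g)]. *)
Lemma invmx_SL2 (K : fieldType) (A : 'M[K]_2) :
  \det A = 1 -> invmx A = (\tr A)%:M - A.
Proof.
move=> detA; have uA : A \in unitmx by rewrite unitmxE detA unitr1.
suff AB : A *m ((\tr A)%:M - A) = 1%:M by rewrite -[RHS](mulKmx uA) AB mulmx1.
have trA : \tr A = A 0 0 + A 1 1.
  by rewrite /mxtrace big_ord_recl big_ord1 lift_ord0_0.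
have {}detA : A 0 0 * A 1 1 - A 0 1 * A 1 0 = 1 by rewrite -det_mx22.
have ord2P (P : 'I_2 -> Prop) : P 0 -> P 1 -> forall i, P i.
  by move=> P0 P1 [[|[|//]] lti]; [move: P0 | move: P1]; congr P; exact/val_inj.
apply/matrixP; apply: (ord2P _); apply: (ord2P _);
  rewrite !mxE big_ord_recl big_ord1 lift_ord0_0 !mxE trA /=;
  rewrite ?mulr0n ?mulr1n -?detA; ring.
Qed.

(** * Comparison of the two displacement functions *)

Section SL2Bounds.
Variables (R : realType) (K : fieldType) (v : K -> R).
Hypothesis hv : nonarch_absval v.
Variable g : PSL2 K.

Let v_ge0 x : 0 <= v x. Proof. exact: absval_ge0 hv x. Qed.

Let A := lift_mx g.
Let a := A 0 0.
Let b := A 0 1.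
Let c := A 1 0.
Let d := A 1 1.
Let N := mobius_norm v g.

Lemma det_lift_mx : a * d - b * c = 1.
Proof. by rewrite -det_mx22; exact/eqP/(valP (repr g)). Qed.

Lemma mobius_norm_gt0 : 0 < N.
Proof.
have [Na Nb _ _] := absval_entry_le_norm hv A.
have : 0 < Num.max (v a) (v b).
  apply: max_absval_gt0 => //; rewrite -negb_and.
  apply/negP => /andP[/eqP a0 /eqP b0].
  by move/eqP: det_lift_mx; rewrite a0 b0 !mul0r subrr eq_sym oner_eq0.
by move/lt_le_trans; apply; rewrite ge_max Na Nb.
Qed.

Lemma mobius_ME :
  mobius_M v g =
    Num.max (v (a - d)) (Num.max (v (2 * b)) (v (2 * c))) / N.
Proof.
rewrite /mobius_M -/N -/A; congr (_ / _).
rewrite invmx_SL2; last by rewrite det_mx22 det_lift_mx.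
have trA : \tr A = a + d.
  by rewrite /mxtrace big_ord_recl big_ord1; congr (_ + A _ _); exact/val_inj.
rewrite mx_normE // !mxE trA -/a -/b -/c -/d /= mulr0n mulr1n.
have -> : a - (a + d - a) = a - d by ring.
have -> : b - (0 - b) = 2 * b by ring.
have -> : c - (0 - c) = 2 * c by ring.
have -> : d - (a + d - d) = d - a by ring.
by rewrite (absvalBC hv d) [Num.max (v (2 * c)) _]maxC maxACA maxxx.
Qed.

(** The columns of [A (0 1 1; 1 1 0)]: the homogeneous coordinates of the
    images of 0, 1 and infinity, and thus never zero vectors. *)
Lemma image_coords_neq0 :
  [/\ (b != 0) || (d != 0), (a + b != 0) || (c + d != 0)
    & (a != 0) || (c != 0)].
Proof.
have nz (x y s t : K) : x * s - y * t = 1 -> (x != 0) || (y != 0).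
  apply: contra_eqT; rewrite negb_or !negbK => /andP[/eqP-> /eqP->].
  by rewrite !mul0r subrr eq_sym oner_neq0.
split.
- by apply: (nz _ _ (- c) (- a)); rewrite -det_lift_mx; ring.
- by apply: (nz _ _ d b); rewrite -det_lift_mx; ring.
- by apply: (nz _ _ d b); rewrite -det_lift_mx; ring.
Qed.

Lemma epsilon1E :
  epsilon1 v g =
    Num.max (v b / Num.max (v b) (v d))
      (Num.max (v (a + b - (c + d)) / Num.max (v (a + b)) (v (c + d)))
               (v c / Num.max (v a) (v c))).
Proof.
have some_pt x : Some x = proj_pt x 1 by rewrite /proj_pt oner_eq0 divr1.
have none_pt : None = proj_pt 1 0 :> P1 K by rewrite /proj_pt eqxx.
have g0 : mobius g (Some 0) = proj_pt b d.
  have -> : proj_pt b d = proj_pt (a * 0 + b) (c * 0 + d).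
    by rewrite !mulr0 !add0r.
  by [].
have g1 : mobius g (Some 1) = proj_pt (a + b) (c + d).
  have -> : proj_pt (a + b) (c + d) = proj_pt (a * 1 + b) (c * 1 + d).
    by rewrite !mulr1.
  by [].
have goo : mobius g None = proj_pt a c by [].
have [nz0 nz1 nzoo] := image_coords_neq0.
have one_nz x : (x != 0) || ((1 : K) != 0) by rewrite oner_neq0 orbT.
have nz10 : ((1 : K) != 0) || ((0 : K) != 0) by rewrite oner_neq0.
rewrite /epsilon1 g0 g1 goo none_pt !some_pt !(chordal_proj_pt hv) //.
rewrite absval0 // absval1 // maxxx (max_r ler01) (max_l ler01).
by rewrite !mulr0 !mulr1 !mul1r !mul0r subr0 sub0r absvalN.
Qed.

Lemma epsilon1_ge0 : 0 <= epsilon1 v g.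
Proof. by rewrite epsilon1E le_max divr_ge0 // le_max v_ge0. Qed.

Lemma mobius_M_le_epsilon1 : mobius_M v g <= epsilon1 v g.
Proof.
have [Na Nb Nc Nd] : [/\ v a <= N, v b <= N, v c <= N & v d <= N].
  exact: absval_entry_le_norm hv A.
have v_le x y : v x <= N -> v y <= N -> v (x + y) <= N.
  by move=> xN yN; rewrite (le_trans (absvalD hv _ _)) // ge_max xN.
have eps_ge0 := epsilon1_ge0.
have num_le x y z : (y != 0) || (z != 0) ->
    v x / Num.max (v y) (v z) <= epsilon1 v g -> v y <= N -> v z <= N ->
    v x <= epsilon1 v g * N.
  move=> /(max_absval_gt0 hv) m_gt0; rewrite ler_pdivrMr // => x_le yN zN.
  by rewrite (le_trans x_le) // ler_wpM2l // ge_max yN.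
have [nz0 nz1 nzoo] := image_coords_neq0.
have b_le : v b <= epsilon1 v g * N.
  by apply: (num_le _ _ _ nz0) => //; rewrite epsilon1E le_max lexx.
have c_le : v c <= epsilon1 v g * N.
  by apply: (num_le _ _ _ nzoo) => //; rewrite epsilon1E !le_max lexx !orbT.
have e_le : v (a + b - (c + d)) <= epsilon1 v g * N.
  apply: (num_le _ _ _ nz1); [|exact: v_le..].
  by rewrite epsilon1E !le_max lexx !orbT.
have v2_le x : v (2 * x) <= v x by rewrite absvalM // ler_piMl // absval_nat_le1.
rewrite mobius_ME ler_pdivrMr ?mobius_norm_gt0 // !ge_max !(le_trans (v2_le _)) //.
(* The image of 1 controls [a - d] up to the off-diagonal terms, which the
   images of 0 and infinity control. *)
have -> : a - d = a + b - (c + d) - (b - c) by ring.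
rewrite (le_trans (absvalB hv _ _)) // ge_max e_le /=.
by rewrite (le_trans (absvalB hv _ _)) // ge_max b_le.
Qed.

Lemma epsilon1_le1 : epsilon1 v g <= 1.
Proof.
have [nz0 nz1 nzoo] := image_coords_neq0.
rewrite epsilon1E !ge_max !ler_pdivrMr ?max_absval_gt0 // !mul1r.
by rewrite absvalB // !le_max !lexx ?orbT.
Qed.

(** Either [g] is far from the identity, and the trivial bound 1 on chordal
    distances is enough, or [A] is so close to a scalar matrix that both columns
    and their sum have the norm of [A]; the quotients in [epsilon1] and in
    [mobius_M] then share their denominator. *)
Lemma epsilon1_le_mobius_M : v 2 * epsilon1 v g <= mobius_M v g.
Proof.
have N_gt0 := mobius_norm_gt0.
rewrite mobius_ME ler_pdivlMr //.
set D := Num.max _ _.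
have [D_ad D_b D_c] : [/\ v (a - d) <= D, v 2 * v b <= D & v 2 * v c <= D].
  by rewrite -!absvalM // !le_max !lexx !orbT.
clearbody D.
have v2_le1 : v 2 <= 1 by exact: absval_nat_le1.
have [D_ge|D_lt] := leP (v 2 * N) D.
  apply: le_trans D_ge; rewrite -mulrA ler_wpM2l //.
  by rewrite ler_piMl ?epsilon1_le1 ?(ltW N_gt0).
have v2_gt0 : 0 < v 2.
  rewrite -(pmulr_lgt0 _ N_gt0); apply: le_lt_trans D_lt.
  exact: le_trans (v_ge0 _) D_ad.
have b_lt : v b < N by rewrite -(ltr_pM2l v2_gt0); exact: le_lt_trans D_lt.
have c_lt : v c < N by rewrite -(ltr_pM2l v2_gt0); exact: le_lt_trans D_lt.
have ad_lt : v (a - d) < N.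
  apply: le_lt_trans D_ad _; apply: lt_le_trans D_lt _.
  by rewrite ler_piMl // (ltW N_gt0).
have [a_ge d_ge] : N <= v a /\ N <= v d.
  have : (N <= v a) || (N <= v d).
    have := lexx N; rewrite {2}/N /mobius_norm mx_normE // !le_max.
    rewrite -/A -/a -/b -/c -/d.
    by rewrite !(leNgt _ (v b)) !(leNgt _ (v c)) b_lt c_lt orbF.
  case/orP=> h; split=> //.
    exact: (absval_le_of_near hv ad_lt).
  by apply: (absval_le_of_near hv) h; rewrite absvalBC.
have ab_ge : N <= v (a + b).
  by apply: (absval_le_of_near hv) a_ge; rewrite opprD addrA subrr sub0r absvalN.
have quot_le x m : v 2 * v x <= D -> N <= m -> v 2 * (v x / m) * N <= D.
  move=> x_le m_ge; have m_gt0 := lt_le_trans N_gt0 m_ge.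
  apply: le_trans x_le; rewrite -mulrA ler_wpM2l // mulrAC ler_pdivrMr //.
  by rewrite ler_wpM2l.
rewrite epsilon1E !maxr_pMr // !maxr_pMl ?(ltW N_gt0) // !ge_max.
rewrite !quot_le ?le_max ?d_ge ?a_ge ?ab_ge ?orbT //.
have -> : a + b - (c + d) = (a - d) + (b - c) by ring.
rewrite -absvalM // mulrDr (le_trans (absvalD hv _ _)) // ge_max.
apply/andP; split; first by rewrite absvalM // (le_trans _ D_ad) // ler_piMl.
by rewrite mulrBr (le_trans (absvalB hv _ _)) // ge_max !absvalM // D_b.
Qed.
End SL2Bounds.

(** * The absolute value of 2 in C_p *)

(** The denominator [p ^ logn p 2] of the absolute value divides 2. *)
Lemma padic_absval2_ge (R : realType) (p : nat) :
  prime p -> 2^-1 <= padic_absval R p 2.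
Proof.
move=> p_prime; have -> : 2 = (2 : int)%:~R :> rat by [].
rewrite /padic_absval intr_eq0 numq_int denq_int /=.
have p_part : (p ^ logn p 2 <= 2)%N by rewrite dvdn_leq // pfactor_dvdnn.
have p_gt0 : (0 < p ^ logn p 2)%N by rewrite expn_gt0 prime_gt0.
by rewrite logn1 expr0 div1r -natrX lef_pV2 ?posrE ?ltr0n // ler_nat.
Qed.

Lemma Cp_absval2_ge (R : realType) (p : nat) (Cp : fieldType) (v : Cp -> R) :
  prime p -> is_Cp p v -> 2^-1 <= v 2.
Proof.
move=> p_prime [Qp [vQp [i [Qpbar [vQpbar [j [k [hQp _ _ hj hCp]]]]]]]].
have -> : 2 = k (j (i 2)) by rewrite !rmorph_nat.
rewrite (completion_isometry hCp) hj (completion_isometry hQp).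
exact: padic_absval2_ge.
Qed.

Theorem theorem1p7 (R : realType) (p : nat) (p_prime : prime p)
    (Cp : fieldType) (v : Cp -> R) (hCp : is_Cp p v) (g : PSL2 Cp) :
  2^-1 * epsilon1 v g <= mobius_M v g /\ mobius_M v g <= epsilon1 v g.
Proof.
have hv : nonarch_absval v.
  by have [? [? [? [? [? [? [? [_ _ _ _ []]]]]]]]] := hCp.
split; last exact: mobius_M_le_epsilon1.
apply: le_trans (epsilon1_le_mobius_M hv g).
by rewrite ler_wpM2r ?epsilon1_ge0 // (Cp_absval2_ge p_prime).
Qed.
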